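(* Let $m,n,r\ge 1$ be integers and let $\mathbb{B}_0,\mathbb{B}_1$, $\varphi[G]$, $\mathscr{G}(\mathcal{F})$, $\mathrm{afiber}_r(\mathcal{F})$ and $D$ be as defined in the context. For all $\mathcal{F}\in \mathtt{S}^m(\mathbb{C}^{n+1})$ the following hold: (i) If $G\in\mathscr{G}(\mathcal{F})$ and $v_1,\ldots,v_r\in\mathbb{C}^n$ are distinct zeros of $\varphi[G]$, then $\mathrm{perm}(v_1,\ldots,v_r)\in \mathrm{afiber}_r(\mathcal{F})$. (ii) If $\mathrm{perm}(v_1,\ldots,v_r)\in \mathrm{afiber}_r(\mathcal{F})$ and $(v_1,\ldots,v_r)\in D$, then there exists a unique $G\in\mathscr{G}(\mathcal{F})$ such that $\varphi[G](v_1)=\cdots=\varphi[G](v_r)=0$.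
   Context: Tensors: $\mathtt{S}^m(\mathbb{C}^{n+1})$ is the space of symmetric tensors $\mathcal{F}=(\mathcal{F}_{i_1\ldots i_m})_{0\le i_1,\ldots,i_m\le n}$ with complex entries. For $u\in\mathbb{C}^{n+1}$ (indexed by $0,\ldots,n$), $u^{\otimes m}$ is the tensor with entries $u_{i_1}\cdots u_{i_m}$. For $k\in\mathbb{Z}$, $\mathbb{N}^n_k=\{\alpha\in\mathbb{N}^n: |\alpha|\le k\}$ with $|\alpha|=\alpha_1+\cdots+\alpha_n$. For $\alpha\in\mathbb{N}^n_m$ one writes $\mathcal{F}_\alpha:=\mathcal{F}_{i_1\ldots i_m}$ whenever $x_{i_1}\cdots x_{i_m}=x^\alpha:=x_1^{\alpha_1}\cdots x_n^{\alpha_n}$ with $x_0:=1$. For $p=\sum_{\alpha\in\mathbb{N}^n_m}p_\alpha x^\alpha$, $\langle p,\mathcal{F}\rangle:=\sum_{\alpha\in\mathbb{N}^n_m}p_\alpha\mathcal{F}_\alpha$. Monomial sets: $\mathbb{B}_0$ is the set of the first $r$ monomials in $x=(x_1,\ldots,x_n)$ in the graded lexicographic order $1, x_1,\ldots,x_n,x_1^2,x_1x_2,\ldots$ (lower degree first; in equal degree $x^\alpha$ precedes $x^\beta$ if the leftmost nonzero entry of $\alpha-\beta$ is positive). $\mathbb{B}_1:=(\mathbb{B}_0\cup x_1\mathbb{B}_0\cup\cdots\cup x_n\mathbb{B}_0)\setminus\mathbb{B}_0$. Write $\beta\in\mathbb{B}_0$ (resp. $\alpha\in\mathbb{B}_1$)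 for $x^\beta\in\mathbb{B}_0$ (resp. $x^\alpha\in\mathbb{B}_1$). Generating matrices: for $G\in\mathbb{C}^{\mathbb{B}_0\times\mathbb{B}_1}$ and $\alpha\in\mathbb{B}_1$, $\varphi[G,\alpha]:=\sum_{\beta\in\mathbb{B}_0}G(\beta,\alpha)x^\beta-x^\alpha$, and $\varphi[G]:=(\varphi[G,\alpha])_{\alpha\in\mathbb{B}_1}$; zeros of $\varphi[G]$ are common zeros in $\mathbb{C}^n$ of these polynomials. $\mathscr{G}(\mathcal{F})$ is the set of generating matrices for $\mathcal{F}$, i.e. of all $G\in\mathbb{C}^{\mathbb{B}_0\times\mathbb{B}_1}$ with $\langle \varphi[G,\alpha]\cdot x^\gamma,\mathcal{F}\rangle=0$ for all $\alpha\in\mathbb{B}_1$ and all $\gamma\in\mathbb{N}^n_{m-|\alpha|}$. $\mathrm{perm}(v_1,\ldots,v_r)$ denotes the set of all permutations of $(v_1,\ldots,v_r)$, and $\mathrm{afiber}_r(\mathcal{F})$ is the set of all $\mathrm{perm}(v_1,\ldots,v_r)$, $v_i\in\mathbb{C}^n$, for which there exist $\lambda_1,\ldots,\lambda_r\in\mathbb{C}$ with $\mathcal{F}=\lambda_1(1,v_1)^{\otimes m}+\cdots+\lambda_r(1,v_r)^{\otimes m}$. For $v\in\mathbb{C}^n$, $[v]_{\mathbb{B}_0}:=(p(v))_{p\in\mathbb{B}_0}$ (column vector), and $D:=\{(v_1,\ldots,v_r)\in(\mathbb{C}^n)^r:\det([v_1]_{\mathbb{B}_0}\ \cdots\ [v_r]_{\mathbb{B}_0})\ne0\}$.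 *)

(* Defs.v *)
From mathcomp Require Import all_boot all_order all_algebra all_fingroup.
From mathcomp Require Import classical_sets reals complex mpoly.

Set Implicit Arguments.
Unset Strict Implicit.
Unset Printing Implicit Defensive.

Import GRing.Theory.
Local Open Scope ring_scope.
Local Open Scope classical_set_scope.

Section Monomials.
Variable n : nat.
Implicit Types a b : 'X_{1..n}.

Definition grlex_lt a b : bool :=
  (mdeg a < mdeg b)%N ||
  ((mdeg a == mdeg b) &&
   [exists i : 'I_n, (b i < a i)%N &&
      [forall j : 'I_n, (j < i)%N ==> (a j == b j)]]).

Definition grlex_le a b : bool := (a == b) || grlex_lt a b.

(* For n >= 1 there are at least r monomials of degree < r, and all of them
   precede the monomials of degree >= r; so the first r monomials overall are
   the first r ones among those of degree < r.  (Only meant for n >= 1.) *)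
Definition B0 (r : nat) : seq 'X_{1..n} :=
  take r (sort grlex_le [seq bmnm c | c <- enum {: 'X_{1..n < r}}]).

Definition B1 (r : nat) : seq 'X_{1..n} :=
  [seq a <- B0 r ++ [seq (U_(i) + b)%MM | i <- enum 'I_n, b <- B0 r]
   | a \notin B0 r].

End Monomials.

Section Tensors.
Variables (C : fieldType) (m n : nat).

Definition tensor := {ffun {ffun 'I_m -> 'I_n.+1} -> C}.

Definition symmetric_tensor : set tensor :=
  [set F | forall (s : 'S_m) (i : {ffun 'I_m -> 'I_n.+1}),
     F [ffun k => i (s k)] = F i].

Definition tensor_power (u : 'rV[C]_n.+1) : tensor :=
  [ffun i : {ffun 'I_m -> 'I_n.+1} => \prod_(k < m) u 0 (i k)].

Definition homogenize (v : 'rV[C]_n) : 'rV[C]_n.+1 :=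
  row_mx (const_mx 1 : 'rV[C]_1) v.

(* The variable of index j, with the convention x_0 = 1. *)
Definition xvar (j : 'I_n.+1) : {mpoly C[n]} :=
  if unlift ord0 j is Some k then 'X_k else 1.

(* F_a := F_{i_1 ... i_m} for any i with x_{i_1} ... x_{i_m} = x^a.  Such an i
   exists iff |a| <= m, and for symmetric F the value does not depend on i. *)
Definition coef_at (F : tensor) (a : 'X_{1..n}) : C :=
  if [pick i : {ffun 'I_m -> 'I_n.+1} | \prod_(k < m) xvar (i k) == 'X_[a]]
  is Some i then F i else 0.

(* <p, F>; only meant for p of degree at most m. *)
Definition pairing (p : {mpoly C[n]}) (F : tensor) : C :=
  \sum_(a : 'X_{1..n < m.+1}) p@_a * coef_at F a.

End Tensors.

Section GeneratingMatrices.
Variables (C : fieldType) (m n r : nat).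

Definition Bmatrix := {ffun seq_sub (B0 n r) * seq_sub (B1 n r) -> C}.

Definition phi (G : Bmatrix) (a : seq_sub (B1 n r)) : {mpoly C[n]} :=
  \sum_(b : seq_sub (B0 n r)) G (b, a) *: 'X_[ssval b] - 'X_[ssval a].

Definition phi_zero (G : Bmatrix) (v : 'rV[C]_n) : Prop :=
  forall a : seq_sub (B1 n r), (phi G a).@[v 0] = 0.

(* |a| + |c| <= m expresses that c is in N^n_{m - |a|}, which is empty when
   m < |a|. *)
Definition generating_matrices (F : tensor C m n) : set Bmatrix :=
  [set G | forall (a : seq_sub (B1 n r)) (c : 'X_{1..n}),
     (mdeg (ssval a) + mdeg c <= m)%N -> pairing (phi G a * 'X_[c]) F = 0].

Definition perm_class (v : {ffun 'I_r -> 'rV[C]_n}) :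
    set {ffun 'I_r -> 'rV[C]_n} :=
  [set w | exists s : 'S_r, w = [ffun j => v (s j)]].

Definition afiber (F : tensor C m n) : set (set {ffun 'I_r -> 'rV[C]_n}) :=
  [set perm_class v | v in
    [set v : {ffun 'I_r -> 'rV[C]_n} | exists lambda : 'I_r -> C,
       F = [ffun i => \sum_(j < r)
              lambda j * tensor_power m (homogenize (v j)) i]]].

Definition eval_B0 (v : 'rV[C]_n) : 'cV[C]_r :=
  \col_(i < r) 'X_[nth 0%MM (B0 n r) i].@[v 0].

Definition D : set {ffun 'I_r -> 'rV[C]_n} :=
  [set v | \det (\matrix_(i < r, j < r) eval_B0 (v j) i 0) != 0].

End GeneratingMatrices.

(* Main.v *)
Require Import Defs.
From mathcomp Require Import all_boot all_order all_algebra all_fingroup.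
From mathcomp Require Import classical_sets reals complex mpoly.

Set Implicit Arguments.
Unset Strict Implicit.
Unset Printing Implicit Defensive.

Import GRing.Theory.
Local Open Scope ring_scope.

(** Both parts come from reading a generating matrix as a recurrence.  The
    equations [phi G a * x^c = 0] say that a linear functional on monomials
    takes at [a + c] the value obtained by combining its values at the [b + c],
    [b] in [B0], with the coefficients [G (b, a)].  Since [B0] is an initial
    segment of the graded lexicographic order, every [b] precedes [a]; hence
    [b + c] precedes [a + c] and has no larger degree.  As every monomial
    outside [B0] has the form [a + c] with [a] in [B1], a functional that
    satisfies the recurrence up to degree [N] and is zero on [B0] is zero up to
    degree [N] ([monomial_functional_eq0]).

    A symmetric tensor of order [m] is a functional on the monomials of degree
    at most [m]; [G] generates it when this functional satisfies the recurrence
    up to degree [m] ([generating_matricesP]).  Moreover [F] is the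
    sum of the [lambda_j (1, v_j)^m] exactly when its functional is
    [sum_j lambda_j * (evaluation at v_j)] ([tensor_decompositionP]).
    Evaluation at a common zero of [phi G] satisfies the recurrence in every
    degree ([phi_zero_recurrence]).

    For (i), a linear relation between the columns [[v_j]_B0] is a combination
    of the evaluations at the [v_j] that is zero on [B0], hence on all
    polynomials; polynomials that separate the distinct [v_j] make it trivial,
    so the matrix of these columns is invertible ([B0_eval_mx_unit]).  One can
    then choose [lambda] so that the two functionals agree on [B0], and they
    agree up to degree [m] because both satisfy the recurrence.

    For (ii), the equations [phi G a (v_j) = 0] form, for each [a], a linear
    system for the coefficients [G (b, a)] whose matrix is invertible on [D];
    its solution is the only candidate, and it generates [F] because [F] is a
    combination of evaluations at zeros of [phi G]. *)

(** * The graded lexicographic order *)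

Lemma mnm_neq0_factor n (d : 'X_{1..n}) :
  d != 0%MM -> exists i e, d = (U_(i) + e)%MM.
Proof.
move=> d_neq0; have [i di_neq0] : exists i, d i != 0%N.
  apply/existsP; move: d_neq0; rewrite -negb_forall.
  apply: contra => /forallP d0; apply/eqP/mnmP => i.
  by rewrite mnm0E; apply/eqP.
by exists i, (d - U_(i))%MM; rewrite addmC submK // lep1mP.
Qed.

Section GradedLexOrder.
Variable n : nat.
Implicit Types a b c : 'X_{1..n}.

(** Inside one degree the graded lexicographic order is the reverse of the
    order that multinomials carry, whose transitivity, totality and
    compatibility with addition can therefore be reused. *)
Lemma grlex_ltE a b :
  grlex_lt a b =
  (mdeg a < mdeg b)%N || (mdeg a == mdeg b) && (b < a)%O.
Proof.
rewrite /grlex_lt; case: (ltngtP (mdeg a) (mdeg b)) => //= eq_deg.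
apply/existsP/(ltmcP (esym eq_deg)) => [[i /andP[lt_i eq_i]] | [i eq_i lt_i]].
  exists i => // j lt_ji; move/forallP/(_ j): eq_i.
  by rewrite lt_ji => /eqP.
exists i; rewrite lt_i; apply/forallP => j; apply/implyP => lt_ji.
by rewrite eq_i.
Qed.

Lemma grlex_leE a b :
  grlex_le a b =
  (mdeg a < mdeg b)%N || (mdeg a == mdeg b) && (b <= a)%O.
Proof.
rewrite /grlex_le grlex_ltE Order.POrderTheory.le_eqVlt (eq_sym b).
by have [->|_] := eqVneq a b; rewrite ?eqxx ?orbT.
Qed.

Lemma grlex_ltxx a : grlex_lt a a = false.
Proof. by rewrite grlex_ltE ltnn Order.POrderTheory.ltxx andbF. Qed.

Lemma grlex_lt_trans : transitive (@grlex_lt n).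
Proof.
move=> b a c; rewrite !grlex_ltE.
case: (ltngtP (mdeg a) (mdeg b)) => //= [ltab _ | ->].
  by case/orP=> [|/andP[/eqP<- _]]; rewrite ?ltab // => /(ltn_trans ltab) ->.
move=> ltba /orP[-> // | /andP[-> ltcb]].
by rewrite (Order.POrderTheory.lt_trans ltcb ltba) orbT.
Qed.

Lemma grlex_le_trans : transitive (@grlex_le n).
Proof.
move=> b a c /orP[/eqP-> //|ltab] /orP[/eqP<-|ltbc].
  by rewrite /grlex_le ltab orbT.
by rewrite /grlex_le (grlex_lt_trans ltab ltbc) orbT.
Qed.

Lemma grlex_le_total : total (@grlex_le n).
Proof.
move=> a b; rewrite !grlex_leE; case: ltngtP => //= _.
exact: Order.TotalTheory.le_total.
Qed.

Lemma grlex_lt_add2r c a b : grlex_lt (a + c)%MM (b + c)%MM = grlex_lt a b.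
Proof. by rewrite !grlex_ltE !mdegD ltn_add2r eqn_add2r ltmc_add2l. Qed.

Lemma grlex_lt_mdeg a b : grlex_lt a b -> (mdeg a <= mdeg b)%N.
Proof. by rewrite grlex_ltE => /orP[/ltnW|/andP[/eqP->]]. Qed.

Lemma grlex_lt0 a : grlex_lt a 0%MM = false.
Proof.
rewrite grlex_ltE mdeg0 ltn0 mdeg_eq0 /=.
by case: eqVneq => // ->; rewrite Order.POrderTheory.ltxx.
Qed.

(** Every predecessor of a monomial of degree at most [N] has degree at most
    [N], so counting predecessors among these finitely many monomials gives a
    measure that makes the order well-founded. *)
Lemma grlex_bounded_ind (N : nat) (P : 'X_{1..n} -> Prop) :
  (forall d, (mdeg d <= N)%N ->
     (forall e, grlex_lt e d -> P e) -> P d) ->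
  forall d, (mdeg d <= N)%N -> P d.
Proof.
move=> IH.
pose below d := [pred c : 'X_{1..n < N.+1} | grlex_lt c d].
move=> d; have [k] := ubnP #|below d|.
elim: k d => // k IHk d; rewrite ltnS => ledk ledN.
apply: IH => // e lted.
have leeN : (mdeg e <= N)%N := leq_trans (grlex_lt_mdeg lted) ledN.
apply: IHk => //; apply: leq_trans ledk; apply: proper_card.
apply/properP; split.
  by apply/fintype.subsetP => c; rewrite !inE => /grlex_lt_trans; apply.
by exists (BMultinom (leeN : (mdeg e < N.+1)%N)); rewrite !inE ?grlex_ltxx.
Qed.

End GradedLexOrder.

(** * The monomial sets *)

Section MonomialSets.
Variables (n r : nat).
Hypotheses (hn : (1 <= n)%N).
Implicit Types a b c d : 'X_{1..n}.

Lemma B0_uniq : uniq (B0 n r).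
Proof.
rewrite take_uniq // sort_uniq map_inj_uniq ?enum_uniq //.
exact: val_inj.
Qed.

(** The powers of a single variable already provide [r] monomials of degree
    less than [r]; this is where [n >= 1] enters. *)
Lemma size_B0 : size (B0 n r) = r.
Proof.
rewrite /B0 size_takel // size_sort size_map -cardT.
pose e0 := Ordinal hn.
have deg_e0 (k : 'I_r) : (mdeg (U_(e0) *+ k)%MM < r)%N.
  by rewrite mdegMn mdeg1 mul1n.
rewrite -{1}(card_ord r).
apply: (@leq_card _ _ (fun k => BMultinom (deg_e0 k))).
move=> j k /(congr1 (fun c : 'X_{1..n < r} => (bmnm c) e0)) /=.
by rewrite !mulmnE mnm1E eqxx !mul1n => /val_inj.
Qed.

Lemma B0_lt a b : a \in B0 n r -> b \notin B0 n r -> grlex_lt a b.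
Proof.
rewrite /B0; set s := sort _ _ => a_in b_notin.
have srt : pairwise (@grlex_le n) (take r s ++ drop r s).
  rewrite cat_take_drop -(sorted_pairwise (@grlex_le_trans n)).
  exact/sort_sorted/grlex_le_total.
have [b_in | b_out] := boolP (b \in s).
  have b_drop : b \in drop r s.
    by move: b_in; rewrite -{1}(cat_take_drop r s) mem_cat (negPf b_notin).
  move: srt; rewrite pairwise_cat => /andP[/allrelP/(_ a b a_in b_drop)].
  by case/orP => [/eqP eq_ab | //]; rewrite -eq_ab a_in in b_notin.
have lt_a : (mdeg a < r)%N.
  by move/mem_take: a_in; rewrite mem_sort => /mapP[c _ ->]; apply: bmdeg.
rewrite grlex_ltE (leq_trans lt_a) // leqNgt.
apply: contra b_out => lt_b; rewrite mem_sort; apply/mapP.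
by exists (BMultinom lt_b); rewrite ?mem_enum.
Qed.

Lemma B1_notin_B0 a : a \in B1 n r -> a \notin B0 n r.
Proof. by rewrite mem_filter => /andP[]. Qed.

Lemma mdeg_B0_B1 a b : b \in B0 n r -> a \in B1 n r -> (mdeg b <= mdeg a)%N.
Proof. by move=> bB0 /B1_notin_B0 /(B0_lt bB0) /grlex_lt_mdeg. Qed.

Lemma zero_in_B0 : (0 < r)%N -> 0%MM \in B0 n r.
Proof.
move=> r_gt0; apply: contraT => /B0_lt lt0.
have nth_in : nth 0%MM (B0 n r) 0 \in B0 n r by rewrite mem_nth ?size_B0.
by have := lt0 _ nth_in; rewrite grlex_lt0.
Qed.

(** On a path from [1] to [d] that multiplies by one variable at a time, the
    first monomial outside [B0] belongs to [B1]. *)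
Lemma outside_B0_factor d : (0 < r)%N -> d \notin B0 n r ->
  exists2 a, a \in B1 n r & exists c, d = (a + c)%MM.
Proof.
move=> r_gt0; have [k] := ubnP (mdeg d); elim: k d => // k IHk d lt_dk dB0.
have d_neq0 : d != 0%MM by apply: contraNneq dB0 => ->; apply: zero_in_B0.
have [i [e dE]] := mnm_neq0_factor d_neq0.
have [eB0 | eB0] := boolP (e \in B0 n r).
  exists d; last by exists 0%MM; rewrite addm0.
  rewrite mem_filter dB0 mem_cat; apply/orP; right.
  by apply/allpairsP; exists (i, e); rewrite mem_enum.
have [|a aB1 [c eqc]] := IHk _ _ eB0.
  by move: lt_dk; rewrite dE mdegD mdeg1.
by exists a => //; exists (U_(i) + c)%MM; rewrite dE eqc !addmA (addmC a).
Qed.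

(** The recurrence writes the value at a monomial outside [B0] in terms of
    values at strictly smaller monomials. *)
Lemma monomial_functional_eq0 (C : fieldType) (G : Bmatrix C n r) (N : nat)
    (l : 'X_{1..n} -> C) :
  (0 < r)%N ->
  (forall b, b \in B0 n r -> l b = 0) ->
  (forall (a : seq_sub (B1 n r)) c, (mdeg (ssval a) + mdeg c <= N)%N ->
     l (ssval a + c)%MM =
     \sum_(b : seq_sub (B0 n r)) G (b, a) * l (ssval b + c)%MM) ->
  forall d, (mdeg d <= N)%N -> l d = 0.
Proof.
move=> r_gt0 l0 lrec; apply: grlex_bounded_ind => d ledN IHd.
have [/l0 // | dB0] := boolP (d \in B0 n r).
have [a aB1 [c dE]] := outside_B0_factor r_gt0 dB0.
have := lrec (SeqSub aB1) c; rewrite /= -mdegD -dE => -> //.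
apply: big1 => b _; rewrite IHd ?mulr0 // dE grlex_lt_add2r.
by apply: B0_lt (ssvalP b) (B1_notin_B0 aB1).
Qed.

End MonomialSets.

(** * Symmetric tensors as functionals on monomials *)

Section SymmetricTensors.
Variables (C : fieldType) (m n : nat).
Implicit Types i : {ffun 'I_m -> 'I_n.+1}.

(** The exponent of [x_{i_1} ... x_{i_m}] under the convention [x_0 = 1]. *)
Definition index_mnm (m : nat) (i : {ffun 'I_m -> 'I_n.+1}) : 'X_{1..n} :=
  (\sum_(k < m) if unlift ord0 (i k) is Some j then U_(j) else 0)%MM.

Lemma index_mnmE i j : index_mnm i j = (\sum_(k < m) (i k == lift ord0 j))%N.
Proof.
rewrite /index_mnm mnm_sumE; apply: eq_bigr => k _.
by case: unliftP => [j' ->|->]; rewrite ?(inj_eq lift_inj) ?mnm1E ?mnm0E.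
Qed.

Lemma mdeg_index_mnm i : (mdeg (index_mnm i) <= m)%N.
Proof.
apply: (@leq_trans (\sum_(k < m) 1)%N); last by rewrite sum1_card card_ord.
rewrite mdeg_sum; apply: leq_sum => k _.
by case: unlift => [j|]; rewrite ?mdeg1 ?mdeg0.
Qed.

Lemma prod_xvar i : \prod_(k < m) xvar C (i k) = 'X_[index_mnm i].
Proof.
rewrite /index_mnm (big_morph _ (@mpolyXD n C) (mpolyX0 n C)).
by apply: eq_bigr => k _; rewrite /xvar; case: unlift => //; rewrite mpolyX0.
Qed.

Lemma mpolyX_inj : injective (@mpolyX n C).
Proof.
move=> a b /(congr1 (fun p : {mpoly C[n]} => p@_b)).
rewrite !mcoeffX eqxx; case: eqVneq => // _ /eqP.
by rewrite eq_sym oner_eq0.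
Qed.

(** The exponent counts the occurrences of each nonzero index; those of [0]
    are then determined, since there are [m] indices in total. *)
Lemma index_mnm_eq_perm i i' : index_mnm i = index_mnm i' ->
  exists s : 'S_m, i = [ffun k => i' (s k)].
Proof.
move=> eq_mnm.
have eq_lift j : (\sum_(k < m) (i k == lift ord0 j) =
                  \sum_(k < m) (i' k == lift ord0 j))%N.
  by rewrite -!index_mnmE eq_mnm.
have total_count (f : {ffun 'I_m -> 'I_n.+1}) :
    (\sum_(x < n.+1) \sum_(k < m) (f k == x) = m)%N.
  rewrite exchange_big /=.
  transitivity (\sum_(k < m) 1)%N; last by rewrite sum1_card card_ord.
  apply: eq_bigr => k _; rewrite (bigD1 (f k)) //= eqxx big1 // => x /negPf.
  by rewrite eq_sym => ->.
have eq_count x : (\sum_(k < m) (i k == x) = \sum_(k < m) (i' k == x))%N.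
  case: (unliftP ord0 x) => [j -> // | ->].
  have := etrans (total_count i) (esym (total_count i')).
  by rewrite !big_ord_recl (eq_bigr _ (fun j _ => eq_lift j)) => /addIn.
have /tuple_permP[s /val_inj eq_s] :
    perm_eq [tuple i k | k < m] [tuple i' k | k < m].
  apply/allP => x _; rewrite /= -!sum1_count !big_map -enumT.
  apply/eqP; rewrite [LHS]big_mkcond [RHS]big_mkcond !big_enum.
  exact: eq_count.
exists s; apply/ffunP => k; rewrite ffunE.
by have /(congr1 (fun t => tnth t k)) := eq_s; rewrite !tnth_mktuple.
Qed.

Lemma index_mnm_surj a : (mdeg a <= m)%N ->
  exists i : {ffun 'I_m -> 'I_n.+1}, index_mnm i = a.
Proof.
elim: m a => [|k IHk] a.
  rewrite leqn0 mdeg_eq0 => /eqP->.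
  by exists [ffun=> ord0]; rewrite /index_mnm big_ord0.
have [-> _ | a_neq0 lea] := eqVneq a 0%MM.
  exists [ffun=> ord0]; rewrite /index_mnm big1 // => j _.
  by rewrite ffunE unlift_none.
have [j [e aE]] := mnm_neq0_factor a_neq0.
have [|i eq_i] := IHk e.
  by move: lea; rewrite aE mdegD mdeg1.
exists [ffun t => if unlift ord0 t is Some t' then i t' else lift ord0 j].
rewrite /index_mnm big_ord_recl ffunE unlift_none liftK aE -eq_i.
by congr (_ + _)%MM; apply: eq_bigr => t _; rewrite ffunE liftK.
Qed.

Lemma coef_at_index_mnm (F : tensor C m n) i :
  symmetric_tensor F -> coef_at F (index_mnm i) = F i.
Proof.
move=> symF; rewrite /coef_at; case: pickP => [i'|/(_ i)]; last first.
  by rewrite prod_xvar eqxx.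
by rewrite prod_xvar => /eqP/mpolyX_inj/index_mnm_eq_perm[s ->]; apply: symF.
Qed.

Lemma homogenize0 (v : 'rV[C]_n) : homogenize v 0 ord0 = 1.
Proof.
transitivity (homogenize v 0 (lshift n (ord0 : 'I_1))).
  by congr (homogenize v 0 _); apply: ord_inj.
by apply: (etrans (row_mxEl _ _ _ _)); rewrite mxE.
Qed.

Lemma homogenize_lift (v : 'rV[C]_n) (j : 'I_n) :
  homogenize v 0 (lift ord0 j) = v 0 j.
Proof.
transitivity (homogenize v 0 (rshift 1 j)); last exact: row_mxEr.
by congr (homogenize v 0 _); apply: ord_inj.
Qed.

Lemma tensor_power_homogenize (v : 'rV[C]_n) i :
  tensor_power m (homogenize v) i = 'X_[index_mnm i].@[v 0].
Proof.
rewrite ffunE -prod_xvar rmorph_prod /=; apply: eq_bigr => k _.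
rewrite /xvar; case: unliftP => [j|] ->.
  by rewrite homogenize_lift mevalXU.
by rewrite homogenize0 meval1.
Qed.

(** The entries of [(1, v)^m] are the values at [v] of the monomials of degree
    at most [m], and symmetry lets a tensor be recovered from its values at
    such monomials. *)
Lemma tensor_decompositionP r (F : tensor C m n) (lambda : 'I_r -> C)
    (v : 'I_r -> 'rV[C]_n) :
  symmetric_tensor F ->
  F = [ffun i => \sum_(j < r) lambda j * tensor_power m (homogenize (v j)) i]
  <-> forall a, (mdeg a <= m)%N ->
        coef_at F a = \sum_(j < r) lambda j * 'X_[a].@[v j 0].
Proof.
move=> symF; split=> [FE a /index_mnm_surj[i <-] | FE].
  rewrite coef_at_index_mnm // {1}FE ffunE.
  by apply: eq_bigr => j _; rewrite tensor_power_homogenize.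
apply/ffunP => i; rewrite ffunE -(coef_at_index_mnm i symF).
rewrite FE ?mdeg_index_mnm //.
by apply: eq_bigr => j _; rewrite tensor_power_homogenize.
Qed.

Lemma pairingX (F : tensor C m n) a :
  (mdeg a <= m)%N -> pairing 'X_[a] F = coef_at F a.
Proof.
move=> lea; rewrite /pairing (bigD1 (BMultinom (lea : (mdeg a < m.+1)%N))) //=.
rewrite mcoeffX eqxx mul1r big1 ?addr0 // => b neq_b.
rewrite mcoeffX; case: eqVneq => [eq_ab|_]; last by rewrite mul0r.
by case/eqP: neq_b; apply: val_inj.
Qed.

Lemma pairingB (F : tensor C m n) p q :
  pairing (p - q) F = pairing p F - pairing q F.
Proof.
rewrite /pairing -sumrB; apply: eq_bigr => a _.
by rewrite mcoeffB mulrBl.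
Qed.

Lemma pairing_sumZ (I : finType) (F : tensor C m n) (g : I -> C)
    (p : I -> {mpoly C[n]}) :
  pairing (\sum_k g k *: p k) F = \sum_k g k * pairing (p k) F.
Proof.
under [RHS]eq_bigr => k _ do rewrite /pairing mulr_sumr.
rewrite exchange_big; apply: eq_bigr => a _.
rewrite raddf_sum mulr_suml; apply: eq_bigr => k _.
by rewrite mulrA /= mcoeffZ.
Qed.

End SymmetricTensors.

(** * Generating matrices and their zeros *)

Section GeneratingMatrices.
Variables (C : fieldType) (m n r : nat).
Hypotheses (hn : (1 <= n)%N) (hr : (1 <= r)%N).
Implicit Types (G : Bmatrix C n r) (v : {ffun 'I_r -> 'rV[C]_n}).

Lemma phi_zeroP G (x : 'rV[C]_n) :
  phi_zero G x <-> forall a : seq_sub (B1 n r),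
    'X_[ssval a].@[x 0] =
    \sum_(b : seq_sub (B0 n r)) G (b, a) * 'X_[ssval b].@[x 0].
Proof.
have phiE a : (phi G a).@[x 0] =
    \sum_(b : seq_sub (B0 n r)) G (b, a) * 'X_[ssval b].@[x 0]
    - 'X_[ssval a].@[x 0].
  rewrite mevalB raddf_sum; congr (_ - _); apply: eq_bigr => b _.
  by rewrite /= mevalZ.
split=> [Gx a | Gx a]; last by rewrite phiE -Gx subrr.
by have := Gx a; rewrite phiE => /eqP; rewrite subr_eq0 => /eqP.
Qed.

(** Multiplying [phi G a = 0] by [x^c] and evaluating at a zero keeps it
    valid, without any bound on the degree of [c]. *)
Lemma phi_zero_recurrence G v (mu : 'I_r -> C) (a : seq_sub (B1 n r)) c :
  (forall j, phi_zero G (v j)) ->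
  \sum_j mu j * 'X_[ssval a + c].@[v j 0] =
  \sum_(b : seq_sub (B0 n r))
    G (b, a) * \sum_j mu j * 'X_[ssval b + c].@[v j 0].
Proof.
move=> Gv; under [RHS]eq_bigr => b _ do rewrite mulr_sumr.
rewrite exchange_big; apply: eq_bigr => j _ /=.
rewrite mpolyXD mevalM; have /phi_zeroP -> := Gv j.
rewrite mulr_suml mulr_sumr; apply: eq_bigr => b _.
by rewrite mpolyXD mevalM -mulrA mulrCA.
Qed.

(** The degree bound, imposed on [a + c] only, extends to all terms because
    elements of [B0] have no larger degree than those of [B1]; otherwise the
    pairing would drop some of them. *)
Lemma pairing_phi (F : tensor C m n) G (a : seq_sub (B1 n r)) c :
  (mdeg (ssval a) + mdeg c <= m)%N ->
  pairing (phi G a * 'X_[c]) F =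
  \sum_(b : seq_sub (B0 n r)) G (b, a) * coef_at F (ssval b + c)%MM
  - coef_at F (ssval a + c)%MM.
Proof.
move=> leac; rewrite /phi mulrBl -mpolyXD pairingB pairingX ?mdegD //.
congr (_ - _); rewrite mulr_suml.
under eq_bigr => b _ do rewrite -scalerAl -mpolyXD.
rewrite pairing_sumZ; apply: eq_bigr => b _; rewrite pairingX // mdegD.
apply: leq_trans leac; rewrite leq_add2r.
exact: mdeg_B0_B1 (ssvalP b) (ssvalP a).
Qed.

Lemma generating_matricesP (F : tensor C m n) G :
  generating_matrices F G <->
  forall (a : seq_sub (B1 n r)) c, (mdeg (ssval a) + mdeg c <= m)%N ->
    coef_at F (ssval a + c)%MM =
    \sum_(b : seq_sub (B0 n r)) G (b, a) * coef_at F (ssval b + c)%MM.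
Proof.
split=> GF a c leac; last by rewrite pairing_phi // -GF // subrr.
have := GF a c leac; rewrite pairing_phi // => /eqP.
by rewrite subr_eq0 => /eqP.
Qed.

(** Permuting the points only permutes the weights, so any representative of
    the class can carry the decomposition. *)
Lemma afiberP (F : tensor C m n) v :
  afiber F (perm_class v) <-> exists lambda : 'I_r -> C,
    F = [ffun i => \sum_(j < r)
           lambda j * tensor_power m (homogenize (v j)) i].
Proof.
split=> [[w [lambda FE] eq_wv] | [lambda FE]]; last first.
  by exists v => //; exists lambda.
have [s vE] : perm_class w v.
  by rewrite eq_wv; exists 1%g; apply/ffunP => j; rewrite ffunE perm1.
have vE' j : v j = w (s j) by rewrite vE ffunE.
exists (lambda \o s); rewrite FE; apply/ffunP => i; rewrite !ffunE.
rewrite (reindex_inj (@perm_inj _ s)); apply: eq_bigr => j _.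
by rewrite /= vE'.
Qed.

Definition B0_eval_mx v : 'M[C]_r :=
  \matrix_(i < r, j < r) 'X_[nth 0%MM (B0 n r) i].@[v j 0].

Lemma D_unitmx v : D v <-> B0_eval_mx v \in unitmx.
Proof.
rewrite unitmxE unitfE /D /=; set M := (X in \det X != 0).
suff -> : B0_eval_mx v = M by [].
by apply/matrixP => i j; rewrite !mxE.
Qed.

Lemma B0_nth_in (i : 'I_r) : nth 0%MM (B0 n r) i \in B0 n r.
Proof. by rewrite mem_nth ?size_B0. Qed.

Definition B0_nth (i : 'I_r) : seq_sub (B0 n r) := SeqSub (B0_nth_in i).

Lemma B0_nth_bij : bijective B0_nth.
Proof.
apply: inj_card_bij => [i j /(congr1 (@ssval _ _))/eqP|].
  by rewrite /= nth_uniq ?size_B0 ?B0_uniq // => /eqP/val_inj.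
by rewrite card_seq_sub ?B0_uniq // size_B0 // card_ord.
Qed.

Lemma sum_B0_mulmx v (g : seq_sub (B0 n r) -> C) j :
  \sum_(b : seq_sub (B0 n r)) g b * 'X_[ssval b].@[v j 0] =
  ((\row_i g (B0_nth i)) *m B0_eval_mx v) 0 j.
Proof.
rewrite mxE (reindex B0_nth) /=; last exact/onW_bij/B0_nth_bij.
by apply: eq_bigr => i _; rewrite !mxE.
Qed.

(** For each [a] the column [G (_, a)] solves a square linear system with
    matrix [B0_eval_mx v] (acting on row vectors). *)
Lemma unique_generating_matrix_of_zeros v : B0_eval_mx v \in unitmx ->
  exists! G : Bmatrix C n r, forall j, phi_zero G (v j).
Proof.
move=> unitM; have [idx nthK idxK] := B0_nth_bij.
pose w (a : seq_sub (B1 n r)) : 'rV[C]_r := \row_j 'X_[ssval a].@[v j 0].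
exists [ffun ba => (w ba.2 *m invmx (B0_eval_mx v)) 0 (idx ba.1)]; split.
  move=> j; apply/phi_zeroP => a; rewrite sum_B0_mulmx.
  rewrite [X in X *m _](_ : _ = w a *m invmx (B0_eval_mx v)) ?mulmxKV ?mxE //.
  by apply/rowP => i; rewrite [LHS]mxE ffunE /= nthK.
move=> G Gv; apply/ffunP => -[b a]; rewrite ffunE /=.
suff -> : w a = (\row_i G (B0_nth i, a)) *m B0_eval_mx v.
  by rewrite mulmxK // mxE idxK.
apply/rowP => j; rewrite mxE -(sum_B0_mulmx v (fun b => G (b, a)) j).
by have /phi_zeroP -> := Gv j.
Qed.

(** A product over [j != k] of affine forms [x_i - v_j(i)], with [i] a
    coordinate where [v_j] and [v_k] differ. *)
Lemma separating_poly v (k : 'I_r) : injective v ->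
  exists p : {mpoly C[n]}, forall j, (p.@[v j 0] == 0) = (j != k).
Proof.
move=> injv.
(* The factor at [j = k] is [1], so the product can run over all [j]. *)
have sep j : exists q : {mpoly C[n]}, (q.@[v k 0] != 0) /\
    (j != k -> q.@[v j 0] = 0).
  have [->|neq_jk] := eqVneq j k.
    by exists 1; rewrite meval1 oner_eq0.
  have [i neq_i] : exists i, (v k - v j) 0 i != 0.
    by apply/rV0Pn; rewrite subr_eq0 (inj_eq injv) eq_sym.
  rewrite !mxE in neq_i; exists ('X_i - (v j 0 i)%:MP).
  by rewrite !mevalB !mevalXU !mevalC subrr.
have [q qP] := fin_all_exists sep.
exists (\prod_j q j) => j; rewrite rmorph_prod.
apply/idP/idP => [/prodf_eq0[j' _] | neq_jk].
  by apply: contraTneq => ->; have [] := qP j'.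
by rewrite (bigD1 j) //= (qP j).2 // mul0r.
Qed.

(** A relation between the evaluations at the [v_j] that holds on [B0] holds on
    all polynomials, in particular on those separating the points. *)
Lemma B0_eval_mx_unit G v : injective v ->
  (forall j, phi_zero G (v j)) -> B0_eval_mx v \in unitmx.
Proof.
move=> injv Gv; rewrite -unitmx_tr -row_free_unit.
apply: inj_row_free => c cM0.
pose l (d : 'X_{1..n}) := \sum_j c 0 j * 'X_[d].@[v j 0].
have l0 d : l d = 0.
  apply: (@monomial_functional_eq0 n r hn C G (mdeg d)) => // [b bB0|a e _].
    have ltb : (index b (B0 n r) < r)%N by rewrite -{2}(size_B0 r hn) index_mem.
    have /rowP/(_ (Ordinal ltb)) := cM0; rewrite !mxE => cM0b.
    rewrite -[RHS]cM0b; apply: eq_bigr => j _.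
    by rewrite !mxE /= nth_index.
  exact: phi_zero_recurrence.
apply/rowP => k; rewrite mxE; have [p pP] := separating_poly k injv.
have : \sum_j c 0 j * p.@[v j 0] = 0.
  rewrite (mpolyE p).
  under eq_bigr => j _ do rewrite raddf_sum mulr_sumr.
  rewrite exchange_big big1_seq // => d _.
  under eq_bigr => j _ do rewrite /= mevalZ mulrCA.
  by rewrite -mulr_sumr -/(l d) l0 mulr0.
rewrite (bigD1 k) //= big1 ?addr0 => [/eqP|j neq_jk].
  by rewrite mulf_eq0 pP eqxx orbF => /eqP.
by move: (pP j); rewrite neq_jk => /eqP->; rewrite mulr0.
Qed.

(** The weights are the ones that match [F] on [B0]; elsewhere the difference
    of the two functionals is governed by their common recurrence. *)
Lemma decomposition_of_zeros (F : tensor C m n) G v :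
  symmetric_tensor F -> generating_matrices F G -> injective v ->
  (forall j, phi_zero G (v j)) -> afiber F (perm_class v).
Proof.
move=> symF /generating_matricesP GF injv Gv.
have unitM := B0_eval_mx_unit injv Gv.
(* The system for [lambda] has one equation for every [b] in [B0]; when the
   degree of [b] exceeds [m], its right-hand side is the default [0]. *)
pose f : 'cV[C]_r := \col_i coef_at F (nth 0%MM (B0 n r) i).
pose lambda j := (invmx (B0_eval_mx v) *m f) j 0.
apply/afiberP; exists lambda; apply/tensor_decompositionP => // d led.
apply/eqP; rewrite -subr_eq0; apply/eqP; move: d led.
apply: (@monomial_functional_eq0 n r hn C G m) => // [b bB0|a e leae].
  have ltb : (index b (B0 n r) < r)%N by rewrite -{2}(size_B0 r hn) index_mem.
  have /colP/(_ (Ordinal ltb)) := mulKVmx unitM f.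
  rewrite !mxE /= nth_index // => <-; apply/eqP; rewrite subr_eq0; apply/eqP.
  by apply: eq_bigr => j _; rewrite mxE /= nth_index // mulrC.
rewrite GF // (phi_zero_recurrence lambda a e Gv) -sumrB.
by apply: eq_bigr => b _; rewrite mulrBr.
Qed.

Lemma generating_of_decomposition (F : tensor C m n) G v :
  symmetric_tensor F -> afiber F (perm_class v) ->
  (forall j, phi_zero G (v j)) -> generating_matrices F G.
Proof.
move=> symF /afiberP[lambda /(tensor_decompositionP _ _ symF) FE] Gv.
apply/generating_matricesP => a c leac.
rewrite FE ?mdegD // (phi_zero_recurrence lambda a c Gv).
apply: eq_bigr => b _; rewrite FE // mdegD.
apply: leq_trans leac; rewrite leq_add2r.
exact: mdeg_B0_B1 (ssvalP b) (ssvalP a).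
Qed.

End GeneratingMatrices.

Theorem theorem3p2 (R : realType) (m n r : nat)
  (hm : (1 <= m)%N) (hn : (1 <= n)%N) (hr : (1 <= r)%N)
  (F : tensor R[i] m n) (hF : symmetric_tensor F) :
  (forall (G : Bmatrix R[i] n r) (v : {ffun 'I_r -> 'rV[R[i]]_n}),
     generating_matrices F G ->
     injective v ->
     (forall j : 'I_r, phi_zero G (v j)) ->
     afiber F (perm_class v)) /\
  (forall v : {ffun 'I_r -> 'rV[R[i]]_n},
     afiber F (perm_class v) ->
     D v ->
     exists! G : Bmatrix R[i] n r,
       generating_matrices F G /\ (forall j : 'I_r, phi_zero G (v j))).
Proof.
split=> [G v GF injv Gv | v Fv /D_unitmx unitM].
  exact: decomposition_of_zeros Gv.
have [G [Gv uniqG]] := unique_generating_matrix_of_zeros hn unitM.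
exists G; split=> [|G' [_ /uniqG]] //.
by split=> //; apply: generating_of_decomposition Gv.
Qed.
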